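(* Let $M$ be a connected manifold with a vector field $N$ and let $g_t$, $t\in[0,\varepsilon)$, be a solution of the Partial Ricci Flow $\partial_t g=-2\,r(g)$ such that $N$ is a unit vector field for $g_0$. Then the flow preserves the length of $N$ and the orthogonality of vectors to $N$. If $N$ is a geodesic vector field (i.e. $\nabla_N N=0$) for $t=0$, then it is geodesic for all $t$.
   Context: For a Riemannian metric $g$ with Levi-Civita connection $\nabla$ and a unit vector field $N$, the curvature operator is $R(X,Y)=\nabla_Y\nabla_X-\nabla_X\nabla_Y+\nabla_{[X,Y]}$, $R(X,Y,Z,V)=g(R(X,Y)Z,V)$, and the partial Ricci curvature is the symmetric $(0,2)$-tensor $r(X,Y)=R(X,N,Y,N)$ for $X,Y\in TM$. In particular $r(N,\cdot)=0$. *)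

(* Defs.v *)
From mathcomp Require Import all_boot all_order all_algebra.
From mathcomp Require Import all_classical all_reals all_analysis.

Set Implicit Arguments.
Unset Strict Implicit.
Unset Printing Implicit Defensive.

Import Order.TTheory GRing.Theory Num.Theory.
Import numFieldNormedType.Exports.

Local Open Scope classical_set_scope.
Local Open Scope ring_scope.

(* [k] times continuously differentiable on [U]; only used for [U] open. *)
Fixpoint Ck (R : realType) (V W : normedModType R) (k : nat)
    (U : set V) (f : V -> W) : Prop :=
  match k with
  | 0 => forall x, U x -> {for x, continuous f}
  | k'.+1 => (forall x, U x -> differentiable f x) /\
             (forall v, Ck k' U ('D_v f))
  end.

Definition smooth_on (R : realType) (V W : normedModType R)
  (U : set V) (f : V -> W) : Prop := forall k, Ck k U f.

(* A homeomorphism from the open set [cdom] onto the open set [cimg]; the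
   values of [cfun] and [cinv] elsewhere are irrelevant. *)
Record chart (R : realType) (n : nat) (M : topologicalType) := Chart {
  cdom : set M;
  cimg : set 'rV[R]_n;
  cfun : M -> 'rV[R]_n;
  cinv : 'rV[R]_n -> M;
  cdom_open : open cdom;
  cimg_open : open cimg;
  cfun_img : forall p, cdom p -> cimg (cfun p);
  cinv_dom : forall x, cimg x -> cdom (cinv x);
  cfunK : forall p, cdom p -> cinv (cfun p) = p;
  cinvK : forall x, cimg x -> cfun (cinv x) = x;
  cfun_continuous : forall p, cdom p -> {for p, continuous cfun};
  cinv_continuous : forall x, cimg x -> {for x, continuous cinv}
}.

(* Smooth manifolds without boundary, of dimension [n].  [chart_at p] is a
   preferred chart around [p]; it serves only to identify the tangent space at
   [p] with R^n, see [tangent]. *)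
Record smooth_manifold (R : realType) (n : nat) := SmoothManifold {
  points :> topologicalType;
  hausdorff_points : hausdorff_space points;
  second_countable_points : @second_countable points;
  atlas : set (chart R n points);
  chart_at : points -> chart R n points;
  chart_at_atlas : forall p, atlas (chart_at p);
  chart_at_dom : forall p, cdom (chart_at p) p;
  transition_smooth : forall c d, atlas c -> atlas d ->
    smooth_on (cimg c `&` cinv c @^-1` cdom d) (cfun d \o cinv c)
}.

Section Manifold.
Variables (R : realType) (n : nat) (M : smooth_manifold R n).

(* A tangent vector at [p] is given by its components in [chart_at p]. *)
Definition tangent (p : M) : Type := 'rV[R]_n.

(* Components of [v] in another chart [c] around [p]. *)
Definition tcoord (c : chart R n M) (p : M) (v : tangent p) : 'rV[R]_n :=
  'D_v (cfun c \o cinv (chart_at p)) (cfun (chart_at p) p).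

Definition vfield : Type := forall p : M, tangent p.

Definition smooth_fun_on (U : set M) (f : M -> R) : Prop :=
  forall c, atlas c -> smooth_on (cimg c `&` cinv c @^-1` U) (f \o cinv c).

Definition vrep (c : chart R n M) (X : vfield) : 'rV[R]_n -> 'rV[R]_n :=
  fun x => tcoord c (X (cinv c x)).

Definition smooth_vfield_on (U : set M) (X : vfield) : Prop :=
  forall c, atlas c -> smooth_on (cimg c `&` cinv c @^-1` U) (vrep c X).

Definition dirder (p : M) (v : tangent p) (f : M -> R) : R :=
  'D_v (f \o cinv (chart_at p)) (cfun (chart_at p) p).

(* In local coordinates, [X, Y]^k = X^i d_i Y^k - Y^i d_i X^k. *)
Definition bracket (X Y : vfield) : vfield := fun p =>
  let c := chart_at p in
  ('D_(X p) (vrep c Y) (cfun c p) - 'D_(Y p) (vrep c X) (cfun c p)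
     : 'rV[R]_n).

Definition vadd (X Y : vfield) : vfield :=
  fun p => ((X p : 'rV[R]_n) + (Y p : 'rV[R]_n) : 'rV[R]_n).

Definition vopp (X : vfield) : vfield := fun p => (- (X p : 'rV[R]_n)).

Definition vscale (f : M -> R) (X : vfield) : vfield :=
  fun p => (f p *: (X p : 'rV[R]_n)).

Definition vzero : vfield := fun p => (0 : 'rV[R]_n).

Record riemannian_metric := RiemannianMetric {
  metric :> forall p : M, tangent p -> tangent p -> R;
  metric_linear : forall (p : M) (a : R) (u v w : 'rV[R]_n),
    @metric p (a *: u + v) w = a * @metric p u w + @metric p v w;
  metric_sym : forall (p : M) (u v : tangent p), metric u v = metric v u;
  metric_pos : forall (p : M) (u : 'rV[R]_n), u != 0 -> 0 < @metric p u u;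
  metric_smooth : forall (U : set M) (X Y : vfield), open U ->
    smooth_vfield_on U X -> smooth_vfield_on U Y ->
    smooth_fun_on U (fun p => metric (X p) (Y p))
}.

Definition len (g : riemannian_metric) (p : M) (v : tangent p) : R :=
  Num.sqrt (g p v v).

Definition unit_vfield (g : riemannian_metric) (N : vfield) : Prop :=
  forall p, len g (N p) = 1.

(* Affine connections on TM, acting on vector fields defined on open subsets.
   Vector fields are total functions here, so [nabla X Y] is only constrained
   on open sets where [X] and [Y] are smooth. *)
Record affine_connection (nabla : vfield -> vfield -> vfield) : Prop :=
  AffineConnection {
  conn_smooth : forall (U : set M) (X Y : vfield), open U ->
    smooth_vfield_on U X -> smooth_vfield_on U Y ->
    smooth_vfield_on U (nabla X Y);
  conn_local : forall (U : set M) (X X' Y Y' : vfield), open U ->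
    smooth_vfield_on U X -> smooth_vfield_on U X' ->
    smooth_vfield_on U Y -> smooth_vfield_on U Y' ->
    (forall p, U p -> X p = X' p) -> (forall p, U p -> Y p = Y' p) ->
    forall p, U p -> nabla X Y p = nabla X' Y' p;
  conn_addl : forall (U : set M) (X X' Y : vfield), open U ->
    smooth_vfield_on U X -> smooth_vfield_on U X' -> smooth_vfield_on U Y ->
    forall p, U p -> nabla (vadd X X') Y p = vadd (nabla X Y) (nabla X' Y) p;
  conn_scalel : forall (U : set M) (f : M -> R) (X Y : vfield), open U ->
    smooth_fun_on U f -> smooth_vfield_on U X -> smooth_vfield_on U Y ->
    forall p, U p -> nabla (vscale f X) Y p = vscale f (nabla X Y) p;
  conn_addr : forall (U : set M) (X Y Y' : vfield), open U ->
    smooth_vfield_on U X -> smooth_vfield_on U Y -> smooth_vfield_on U Y' ->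
    forall p, U p -> nabla X (vadd Y Y') p = vadd (nabla X Y) (nabla X Y') p;
  conn_leibniz : forall (U : set M) (f : M -> R) (X Y : vfield), open U ->
    smooth_fun_on U f -> smooth_vfield_on U X -> smooth_vfield_on U Y ->
    forall p, U p -> nabla X (vscale f Y) p =
      vadd (vscale (fun q => dirder (X q) f) Y) (vscale f (nabla X Y)) p
}.

Record levi_civita (g : riemannian_metric)
    (nabla : vfield -> vfield -> vfield) : Prop := LeviCivita {
  lc_connection : affine_connection nabla;
  lc_torsion_free : forall (U : set M) (X Y : vfield), open U ->
    smooth_vfield_on U X -> smooth_vfield_on U Y ->
    forall p, U p -> vadd (nabla X Y) (vopp (nabla Y X)) p = bracket X Y p;
  lc_metric : forall (U : set M) (X Y Z : vfield), open U ->
    smooth_vfield_on U X -> smooth_vfield_on U Y -> smooth_vfield_on U Z ->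
    forall p, U p -> dirder (X p) (fun q => g q (Y q) (Z q)) =
      g p (nabla X Y p) (Z p) + g p (Y p) (nabla X Z p)
}.

(* Sign convention:
   R(X,Y) = nabla_Y nabla_X - nabla_X nabla_Y + nabla_[X,Y]. *)
Definition curv (nabla : vfield -> vfield -> vfield) (X Y Z : vfield) : vfield :=
  vadd (vadd (nabla Y (nabla X Z)) (vopp (nabla X (nabla Y Z))))
       (nabla (bracket X Y) Z).

Definition curv4 (g : riemannian_metric) (nabla : vfield -> vfield -> vfield)
    (X Y Z V : vfield) (p : M) : R :=
  g p (curv nabla X Y Z p) (V p).

Definition partial_ricci (g : riemannian_metric)
    (nabla : vfield -> vfield -> vfield) (N X Y : vfield) (p : M) : R :=
  curv4 g nabla X N Y N p.

Definition geodesic_vfield (nabla : vfield -> vfield -> vfield) (N : vfield) :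
  Prop := forall p, nabla N N p = vzero p.

(* Derivative relative to [0, eps[, hence one-sided at 0. *)
Definition has_time_derivative (eps : R) (f : R -> R) (t d : R) : Prop :=
  (fun s => (s - t)^-1 * (f s - f t)) @
    within [set s | 0 <= s < eps] t^' --> d.

(* The partial Ricci tensor at [p] is evaluated on tangent vectors through
   arbitrary local smooth extensions [X] and [Y]. *)
Definition partial_ricci_flow (N : vfield) (eps : R)
    (g : R -> riemannian_metric) (nabla : R -> vfield -> vfield -> vfield) :
    Prop :=
  forall t, 0 <= t < eps ->
  forall (U : set M) (X Y : vfield), open U ->
    smooth_vfield_on U X -> smooth_vfield_on U Y ->
  forall p, U p ->
    has_time_derivative eps (fun s => g s p (X p) (Y p)) t
      (- 2 * partial_ricci (g t) (nabla t) N X Y p).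

End Manifold.

(* Main.v *)
(* The curvature R(N,N) vanishes, so r(N, .) = 0 and every product g_t(N, Y) is
   constant in t: this gives the claims on lengths and orthogonality.  By
   Koszul's formula,
     2 g(nabla_N N, Y) = 2 N(g(N,Y)) - Y(g(N,N)) - 2 g(N, [N,Y])
   involves the metric only through the products g(N, .), so the left-hand side
   does not depend on t either; if it vanishes at t = 0 for every Y, then
   nabla_N N = 0 at all times because g_t is nondegenerate. *)

Require Import Defs.
From mathcomp Require Import all_boot all_order all_algebra.
From mathcomp Require Import all_classical all_reals all_analysis.
From mathcomp Require Import ring.
Import Order.TTheory GRing.Theory Num.Theory.
Import numFieldNormedType.Exports.
Local Open Scope classical_set_scope.
Local Open Scope ring_scope.

(** * Calculus of k times continuously differentiable maps *)

Lemma near_eq_differentiable {R : numFieldType} {V W : normedModType R}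
    {f g : V -> W} {x : V} :
  (\near x, f x = g x) -> differentiable f x -> differentiable g x.
Proof.
move=> fg /diff_locallyP[cdf fE].
(* [g] inherits the first-order expansion of [f], and uniqueness of the differential then identifies
   ['d g x] with ['d f x]. *)
have gE : g \o shift x = cst (g x) + 'd f x +o_ 0 id.
  apply/eqaddoP => e e0; move/eqaddoP : fE => /(_ e e0).
  apply: filterS2 => [h fgh|]; last first.
    by move: fg; rewrite (near_shift 0) /= subr0; exact.
  by rewrite !fctE /= -fgh (nbhs_singleton fg).
apply/diff_locallyP; rewrite (diff_unique cdf gE).
by split.
Qed.

Section Ck_theory.
Context {R : realType} {V : normedModType R}.

(** Around each point of an open set the two maps agree on a neighbourhood, so the agreement passes
    to continuity, differentiability and ['D_v], and the induction continues. *)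
Lemma Ck_eq (W : normedModType R) k (U : set V) (f g : V -> W) :
  open U -> (forall x, U x -> f x = g x) -> Ck k U f -> Ck k U g.
Proof.
move=> Uo; elim: k f g => [|k IH] f g fg /=.
  move=> fc x Ux; have fgx : \near x, f x = g x.
    by apply: filterS (open_nbhs_nbhs (conj Uo Ux)) => y /fg.
  rewrite /prop_for /continuous_at -fg//; apply: cvg_trans (fc x Ux).
  exact: near_eq_cvg.
have near_fg x : U x -> \near x, f x = g x.
  by move=> Ux; apply: filterS (open_nbhs_nbhs (conj Uo Ux)) => y /fg.
move=> [df Df]; split=> [x Ux|v].
  by apply: near_eq_differentiable (df x Ux); exact: near_fg.
by apply: IH (Df v) => x Ux; apply: near_eq_derive; exact: near_fg.
Qed.

Lemma Ck_subset (W : normedModType R) k (U U' : set V) (f : V -> W) :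
  U `<=` U' -> Ck k U' f -> Ck k U f.
Proof.
move=> UU'; elim: k f => [|k IH] f /= => [fc x /UU'|[df Df]]; first exact: fc.
by split=> [x /UU'/df//|v]; exact: IH.
Qed.

Lemma CkS (W : normedModType R) k (U : set V) (f : V -> W) :
  Ck k.+1 U f -> Ck k U f.
Proof.
elim: k f => [|k IH] f [df Df].
  by move=> x Ux; exact/differentiable_continuous/df.
by split=> // v; exact: IH.
Qed.

Lemma Ck_cst (W : normedModType R) k (U : set V) (a : W) :
  Ck k U (cst a : V -> W).
Proof.
elim: k a => [|k IH] a /=; first by move=> x _; exact: cvg_cst.
split=> [//|v].
rewrite (_ : 'D_v _ = cst 0); first exact: IH.
by apply/funext => x; rewrite derive_cst.
Qed.

Lemma CkD (W : normedModType R) k (U : set V) (f g : V -> W) :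
  open U -> Ck k U f -> Ck k U g -> Ck k U (f + g).
Proof.
move=> Uo; elim: k f g => [|k IH] f g /=.
  by move=> fc gc x Ux; apply: continuousD; [exact: fc|exact: gc].
move=> [df Df] [dg Dg]; split=> [x Ux|v].
  by apply: differentiableD; [exact: df|exact: dg].
apply: (@Ck_eq _ _ _ ('D_v f + 'D_v g)) => //; last exact: IH.
by move=> x Ux; rewrite deriveD//; apply: diff_derivable; [exact: df|exact: dg].
Qed.

Lemma Ck_sum (W : normedModType R) k (U : set V) m (f : 'I_m -> V -> W) :
  open U -> (forall i, Ck k U (f i)) -> Ck k U (\sum_(i < m) f i).
Proof.
move=> Uo fk; elim/big_ind : _ => //; first exact: (@Ck_cst _ k U 0).
by move=> g h; exact: CkD.
Qed.

Lemma CkM k (U : set V) (f g : V -> R) :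
  open U -> Ck k U f -> Ck k U g -> Ck k U (f * g).
Proof.
move=> Uo; elim: k f g => [|k IH] f g.
  by move=> fc gc x Ux; apply: continuousM; [exact: fc|exact: gc].
move=> fk gk; have [df Df] := fk; have [dg Dg] := gk; split=> [x Ux|v].
  by apply: differentiableM; [exact: df|exact: dg].
apply: (@Ck_eq _ _ _ (f * 'D_v g + g * 'D_v f)) => //.
  by move=> x Ux; rewrite deriveM//; apply: diff_derivable;
    [exact: df|exact: dg].
by apply: CkD => //; apply: IH; [exact: CkS|exact: Dg|exact: CkS|exact: Df].
Qed.

Lemma derive_scalel (W : normedModType R) (f : V -> R) (a : W) x v :
  differentiable f x -> 'D_v (fun y => f y *: a) x = 'D_v f x *: a.
Proof.
by move=> df; rewrite !deriveE ?diffZl//; exact: differentiableZl.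
Qed.

Lemma CkZl (W : normedModType R) k (U : set V) (f : V -> R) (a : W) :
  open U -> Ck k U f -> Ck k U (fun x => f x *: a).
Proof.
move=> Uo; elim: k f => [|k IH] f /=.
  by move=> fc x Ux; apply: cvgZr_tmp; exact: fc.
move=> [df Df]; split=> [x Ux|v]; first by apply: differentiableZl; exact: df.
apply: (@Ck_eq _ _ _ (fun x => 'D_v f x *: a)) => //; last exact: IH.
by move=> x Ux; rewrite derive_scalel//; exact: df.
Qed.

Lemma Ck_coord k n (U : set V) (h : V -> 'rV[R]_n) i :
  open U -> Ck k U h -> Ck k U (fun x => h x 0 i).
Proof.
move=> Uo; elim: k h => [|k IH] h /=.
  move=> hc x Ux; apply: (@continuous_comp _ _ _ h (fun u => u 0 i)).
    exact: hc.
  exact: coord_continuous.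
move=> [dh Dh]; split=> [x Ux|v].
  apply: (@differentiable_comp _ _ _ _ h (fun u => u 0 i)).
    exact: dh.
  exact: differentiable_coord.
apply: (@Ck_eq _ _ _ (fun x => 'D_v h x 0 i)) => //; last exact: IH.
by move=> x Ux; rewrite derive_mx ?mxE//; exact/diff_derivable/dh.
Qed.

Lemma Ck_rV k n (U : set V) (h : V -> 'rV[R]_n) :
  open U -> (forall i, Ck k U (fun x => h x 0 i)) -> Ck k U h.
Proof.
move=> Uo hk.
apply: (@Ck_eq _ _ _ (\sum_(i < n) (fun x => h x 0 i *: 'e_i))) => //.
  by move=> x _; rewrite fct_sumE -row_sum_delta.
by apply: Ck_sum => // i; exact: CkZl.
Qed.

Lemma derive_comp_rV (W : normedModType R) n (f : 'rV[R]_n -> W)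
    (h : V -> 'rV[R]_n) x v :
  differentiable h x -> differentiable f (h x) ->
  'D_v (f \o h) x = 'D_('D_v h x) f (h x).
Proof.
move=> dh df; rewrite !deriveE//; last exact: differentiable_comp.
by rewrite diff_comp.
Qed.

Lemma derive_sum_dir (W : normedModType R) n (f : 'rV[R]_n -> W) y u :
  differentiable f y -> 'D_u f y = \sum_(i < n) u 0 i *: 'D_('e_i) f y.
Proof.
move=> df; rewrite [in LHS](row_sum_delta u) deriveE// linear_sum.
by apply: eq_bigr => i _; rewrite linearZ/= deriveE.
Qed.

(** [Ck] only speaks of derivatives in fixed directions, whereas the chain rule differentiates [f]
    along ['D_v h x], which moves with [x]. Expanding this direction in the standard basis leaves
    products of components of ['D_v h] with ['D_('e_i) f \o h], to which [CkM] and the induction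
    hypothesis apply. *)
Lemma Ck_comp_scalar k n (U : set V) (U' : set 'rV[R]_n) (f : 'rV[R]_n -> R)
    (h : V -> 'rV[R]_n) :
  open U -> (forall x, U x -> U' (h x)) ->
  Ck k U' f -> Ck k U h -> Ck k U (f \o h).
Proof.
move=> Uo hU; elim: k f => [|k IH] f.
  move=> fc hc x Ux; apply: continuous_comp; first exact: hc.
  exact/fc/hU.
move=> [df Df] hk; have [dh Dh] := hk; split=> [x Ux|v].
  apply: differentiable_comp; first exact: dh.
  by apply: df; exact: hU.
apply: (@Ck_eq _ _ _
    (\sum_(i < n) ((fun x => 'D_v h x 0 i) * ('D_('e_i) f \o h)))) => //.
  move=> x Ux; rewrite fct_sumE derive_comp_rV; [|exact: dh|exact/df/hU].
  rewrite derive_sum_dir//; exact/df/hU.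
apply: Ck_sum => // i; apply: CkM => //.
  by apply: Ck_coord => //; exact: Dh.
by apply: IH; [exact: Df|exact: CkS].
Qed.

End Ck_theory.

Lemma Ck_comp {R : realType} {V : normedModType R} k n m (U : set V) (U' : set 'rV[R]_n)
    (f : 'rV[R]_n -> 'rV[R]_m) (h : V -> 'rV[R]_n) :
  open U -> open U' -> (forall x, U x -> U' (h x)) ->
  Ck k U' f -> Ck k U h -> Ck k U (f \o h).
Proof.
move=> Uo U'o hU fk hk; apply: Ck_rV => // i.
by apply: (@Ck_comp_scalar R V k n U U' (fun y => f y 0 i)) => //; exact: Ck_coord.
Qed.

(** * Functions of time with one-sided derivative at 0 *)

Lemma near_time_derivative {R : realType} {eps : R} {f : R -> R} {t d : R} :
  has_time_derivative eps f t d -> forall e, 0 < e ->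
  \forall s \near t, s != t -> 0 <= s < eps ->
    `|d - (s - t)^-1 * (f s - f t)| < e.
Proof. by move=> /cvgrPdist_lt + e e0 => /(_ e e0). Qed.

Lemma is_derive_time_derivative {R : realType} {eps : R} {f : R -> R} {t d : R} :
  0 < t < eps -> has_time_derivative eps f t d -> is_derive t 1 f d.
Proof.
move=> /andP[t0 te] fd.
have fc : (fun h => h^-1 *: ((f \o shift t) (h *: 1) - f t)) @ 0^' --> d.
  apply/cvgrPdist_lt => e e0.
  have tD : \forall s \near t, 0 <= s < eps.
    near=> s; apply/andP; split; first by apply/ltW; near: s; exact: lt_nbhsr.
    by near: s; exact: lt_nbhsl.
  have : \forall s \near t, s != t -> `|d - (s - t)^-1 * (f s - f t)| < e.
    apply: filterS2 tD (near_time_derivative fd e e0) => s sD sd st.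
    exact: sd.
  rewrite (near_shift 0) /= subr0; apply: filterS => h /= + h0.
  rewrite -subr_eq0 !addrK [h *: 1]mulr1; exact.
by apply: DeriveDef; [exact: (cvgP d)|exact: cvg_lim].
Unshelve. all: by end_near. Qed.

(** The mean value theorem on [[0, t]] wants two-sided derivatives only in the interior, where [[0,
    eps[] is a neighbourhood of each point. At 0 right continuity suffices. *)
Lemma eq_time_derivative0 {R : realType} (eps : R) (f : R -> R) :
  (forall t, 0 <= t < eps -> has_time_derivative eps f t 0) ->
  forall t, 0 <= t < eps -> f t = f 0.
Proof.
move=> df t /andP[]; rewrite le_eqVlt => /predU1P[<-//|t0 te].
have dfi x : 0 < x < eps -> is_derive x 1 f 0.
  move=> /andP[x0 xe]; apply: (@is_derive_time_derivative _ eps); first by rewrite x0 xe.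
  by apply: df; rewrite xe ltW.
have cf : {within `[0, t], continuous f}.
  have cfi x : 0 < x < eps -> {for x, continuous f}.
    by move=> /dfi ?; exact/differentiable_continuous/derivable1_diffP.
  apply/continuous_within_itvP => //; split.
  - move=> x; rewrite in_itv/= => /andP[x0 xt].
    by apply: cfi; rewrite x0 (lt_trans xt).
  - apply/cvgrPdist_lt => e e0.
    have df0 : has_time_derivative eps f 0 0.
      by apply: df; rewrite lexx (lt_trans t0).
    (* Since the derivative at 0 vanishes, tolerance 1 on the difference quotient gives
       [|f s - f 0| < s] for small [s > 0], and [s < e] finishes. *)
    have /near_time_derivative/(_ _ ltr01) := df0.
    have : \forall s \near nbhs (0 : R), s < e by exact: lt_nbhsl.
    have : \forall s \near nbhs (0 : R), s < eps.
      by apply: lt_nbhsl; exact: lt_trans te.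
    apply: filterS3 => s seps se sd s0.
    rewrite sub0r normrN in sd.
    have sn0 : s != 0 by rewrite gt_eqF.
    have := sd sn0 _; rewrite seps ltW// subr0 normrM normfV (gtr0_norm s0).
    by move=> /(_ isT); rewrite ltr_pdivrMl// mulr1 distrC => /lt_trans; exact.
  - by apply: cvg_at_left_filter; apply: cfi; rewrite t0.
have dfio x : x \in `]0, t[ -> is_derive x 1 f 0.
  rewrite in_itv/= => /andP[x0 xt].
  by apply: dfi; rewrite x0 (lt_trans xt).
have [c _] := @MVT _ _ (cst 0) _ _ t0 dfio cf.
by rewrite mul0r => /eqP; rewrite subr_eq0 => /eqP.
Qed.

(** * Extending tangent vectors to local smooth fields *)

Section local_extension.
Context {R : realType} {n : nat}.

Lemma open_chart_preimage {M : topologicalType} (c : chart R n M) (U : set M) :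
  open U -> open (cimg c `&` cinv c @^-1` U).
Proof.
move=> Uo; rewrite openE => x [cx Ux]; apply: filterI.
  by apply: open_nbhs_nbhs; split=> //; exact: cimg_open.
by apply: (cinv_continuous cx); apply: open_nbhs_nbhs.
Qed.

Context {M : smooth_manifold R n}.
Implicit Types (c d : chart R n M) (p q : M) (v : 'rV[R]_n).

(* The field whose components in [c] are constantly [v], rewritten in the
   preferred chart of each point; junk outside [cdom c]. *)
Definition coord_field c v : vfield M :=
  fun q => 'D_v (cfun (chart_at q) \o cinv c) (cfun c q).

Lemma cfun_transition_dom c d q : cdom c q -> cdom d q ->
  (cimg c `&` cinv c @^-1` cdom d) (cfun c q).
Proof. by move=> cq dq; split=> /=; [exact: cfun_img|rewrite cfunK]. Qed.

Lemma transition_differentiable c d q : atlas c -> atlas d ->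
  cdom c q -> cdom d q -> differentiable (cfun d \o cinv c) (cfun c q).
Proof.
move=> ac ad cq dq; have [+ _] := transition_smooth ac ad 1.
by apply; exact: cfun_transition_dom.
Qed.

(** The preferred chart [e] at [q] enters twice and cancels: near [cfun c q] the transition from [c]
    to [d] factors through [e], and the chain rule applies. *)
Lemma tcoord_coord_field c d q v : atlas c -> atlas d ->
  cdom c q -> cdom d q ->
  tcoord d (coord_field c v q) = 'D_v (cfun d \o cinv c) (cfun c q).
Proof.
move=> ac ad cq dq; pose e := chart_at q.
have ae : atlas e := chart_at_atlas q.
have eq : cdom e q := chart_at_dom q.
have eqE : cfun e q = (cfun e \o cinv c) (cfun c q) by rewrite /= cfunK.
rewrite /tcoord /coord_field -/e [in LHS]eqE -derive_comp_rV; first last.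
- by rewrite -eqE; exact: transition_differentiable.
- exact: transition_differentiable.
apply: near_eq_derive.
have := open_nbhs_nbhs (conj (open_chart_preimage c _ (cdom_open e))
  (cfun_transition_dom _ _ _ cq eq)).
by apply: filterS => x [cx ex] /=; rewrite cfunK.
Qed.

(** The preferred chart varies with the point without any regularity, so smoothness is read from
    [tcoord_coord_field], where only transitions between the fixed charts [c] and [d] remain. *)
Lemma coord_field_smooth c v : atlas c ->
  smooth_vfield_on (cdom c) (coord_field c v).
Proof.
move=> ac d ad k.
have cdo := open_chart_preimage d _ (cdom_open c).
have dco := open_chart_preimage c _ (cdom_open d).
apply: (@Ck_eq _ _ _ _ _ ('D_v (cfun d \o cinv c) \o (cfun c \o cinv d))) => //.
  move=> x [dx cx] /=; rewrite /vrep tcoord_coord_field//.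
  exact: cinv_dom.
apply: (Ck_comp _ _ _ _ _ _ _ cdo dco).
- move=> x [dx cx]; apply: cfun_transition_dom => //.
  exact: cinv_dom.
(* One order is spent on the derivative ['D_v] of the transition. *)
- by have [_] := transition_smooth ac ad k.+1; exact.
- exact: transition_smooth.
Qed.

(** Makes every tangent vector the value of a locally smooth field. A chart composed with its own
    inverse is the identity near the base point. *)
Lemma coord_field_chart_at p v : coord_field (chart_at p) v p = v.
Proof.
rewrite /coord_field -[RHS](derive_id (cfun (chart_at p) p) v).
apply: near_eq_derive.
have := open_nbhs_nbhs (conj (@cimg_open _ _ _ (chart_at p))
  (cfun_img (chart_at_dom p))).
by apply: filterS => x px /=; rewrite cinvK.
Qed.

Lemma smooth_vfield_on_subset (U U' : set M) (X : vfield M) :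
  U `<=` U' -> smooth_vfield_on U' X -> smooth_vfield_on U X.
Proof.
move=> UU' X_smooth c ac k; apply: Ck_subset (X_smooth c ac k).
by move=> x [cx Ux]; split=> //; exact: UU'.
Qed.

Lemma smooth_vzero (U : set M) : smooth_vfield_on U (@vzero R n M).
Proof.
move=> c ac k; rewrite (_ : vrep _ _ = cst 0); first exact: Ck_cst.
by apply/funext => x; exact: derive0.
Qed.

End local_extension.

(** * Curvature and Koszul identities on the diagonal *)

Section metric_theory.
Context {R : realType} {n : nat} {M : smooth_manifold R n}.
Implicit Types (g : riemannian_metric M) (p : M) (u v w : 'rV[R]_n).

Lemma metric0l g p w : g p 0 w = 0.
Proof.
have := metric_linear g p 1 0 0 w.
by rewrite scaler0 addr0 mul1r => /eqP; rewrite -subr_eq subrr => /eqP.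
Qed.

Lemma metricBr g p u v w : g p w (u - v) = g p w u - g p w v.
Proof.
by rewrite addrC -scaleN1r Defs.metric_sym metric_linear mulN1r addrC
  !(Defs.metric_sym _ w).
Qed.

(** The two second-order terms cancel and the bracket of a field with itself is zero everywhere.
    Additivity in the first slot, applied to [0 + 0], kills the remaining term. *)
Lemma curv_diag nabla (U : set M) (X Z : vfield M) p :
  affine_connection nabla -> open U -> smooth_vfield_on U Z -> U p ->
  curv nabla X X Z p = vzero p.
Proof.
move=> conn Uo Zs Up.
have -> : curv nabla X X Z p = nabla (bracket X X) Z p.
  by rewrite /curv /vadd /vopp subrr add0r.
have -> : bracket X X = @vzero R n M by apply/funext => q; exact: subrr.
have zs := smooth_vzero U.
have := conn_addl conn Uo zs zs Zs Up.
have -> : vadd (@vzero R n M) (@vzero R n M) = @vzero R n M.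
  by apply/funext => q; exact: addr0.
by rewrite /vadd => /eqP; rewrite -subr_eq subrr eq_sym => /eqP.
Qed.

(** Metric compatibility expands both derivatives and torsion-freeness replaces the bracket by
    [nabla N Y - nabla Y N]; the terms in [nabla N Y] and [nabla Y N] then cancel. *)
Lemma metric_nabla_diag g nabla (U : set M) (N Y : vfield M) p :
  levi_civita g nabla -> open U ->
  smooth_vfield_on U N -> smooth_vfield_on U Y -> U p ->
  2 * g p (nabla N N p) (Y p) =
    2 * dirder (N p) (fun q => g q (N q) (Y q))
    - dirder (Y p) (fun q => g q (N q) (N q))
    - 2 * g p (N p) (bracket N Y p).
Proof.
move=> lc Uo Ns Ys Up.
rewrite (lc_metric lc Uo Ns Ns Ys Up) (lc_metric lc Uo Ys Ns Ns Up).
rewrite -(lc_torsion_free lc Uo Ns Ys Up) /vadd /vopp metricBr.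
rewrite (Defs.metric_sym _ (nabla Y N p)).
ring.
Qed.

End metric_theory.

(** * Consequences of the flow equation *)

Lemma partial_ricci_flow_metric {R : realType} {n : nat}
    {M : smooth_manifold R n} {N : vfield M} {eps : R}
    {g : R -> riemannian_metric M}
    {nabla : R -> vfield M -> vfield M -> vfield M} :
  smooth_vfield_on setT N ->
  (forall t, 0 <= t < eps -> levi_civita (g t) (nabla t)) ->
  partial_ricci_flow N eps g nabla ->
  forall t, 0 <= t < eps ->
  forall p (v : tangent p), g t p (N p) v = g 0 p (N p) v.
Proof.
move=> Ns lc flow t tD p v.
pose c := chart_at p; pose Y := coord_field c v.
have Ys : smooth_vfield_on (cdom c) Y.
  exact/coord_field_smooth/chart_at_atlas.
have NsU : smooth_vfield_on (cdom c) N by exact: smooth_vfield_on_subset Ns.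
have Up : cdom c p := chart_at_dom p.
(* The flow equation is stated for fields smooth on an open set, so [v] is replaced by the value at
   [p] of its extension [Y]. *)
rewrite -(coord_field_chart_at p v).
apply: (@eq_time_derivative0 _ eps (fun s => g s p (N p) (Y p))) => // s sD.
have := flow s sD _ _ _ (cdom_open c) NsU Ys p Up.
rewrite /partial_ricci /curv4.
rewrite (curv_diag _ _ _ _ _ (lc_connection (lc s sD)) (cdom_open c) Ys Up).
by rewrite metric0l mulr0.
Qed.

Theorem proposition2 (R : realType) (n : nat) (M : smooth_manifold R n)
    (M_connected : connected [set: M])
    (N : vfield M) (N_smooth : smooth_vfield_on setT N)
    (eps : R) (eps_gt0 : 0 < eps)
    (g : R -> riemannian_metric M)
    (nabla : R -> vfield M -> vfield M -> vfield M)
    (nabla_lc : forall t, 0 <= t < eps -> levi_civita (g t) (nabla t))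
    (g_flow : partial_ricci_flow N eps g nabla)
    (N_unit : unit_vfield (g 0) N) :
  (forall t, 0 <= t < eps ->
     (forall p : M, len (g t) (N p) = len (g 0) (N p)) /\
     (forall (p : M) (v : tangent p),
        g t p v (N p) = 0 <-> g 0 p v (N p) = 0)) /\
  (geodesic_vfield (nabla 0) N ->
     forall t, 0 <= t < eps -> geodesic_vfield (nabla t) N).
Proof.
have gN := partial_ricci_flow_metric N_smooth nabla_lc g_flow.
split=> [t tD|geo0 t tD p]; first split=> [p|p v].
- by rewrite /len gN.
- by rewrite !(Defs.metric_sym _ v) gN.
have zD : 0 <= (0 : R) < eps by rewrite lexx.
(* The test field [Y] extends the very vector [w] that must vanish: once the pairing of [w] with
   [Y p] under [g t] is known to be 0, positivity forces [w = 0]. *)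
pose c := chart_at p; pose w : 'rV[R]_n := nabla t N N p.
pose Y := coord_field c w.
have Ys : smooth_vfield_on (cdom c) Y.
  exact/coord_field_smooth/chart_at_atlas.
have Ns : smooth_vfield_on (cdom c) N by exact: smooth_vfield_on_subset N_smooth.
have Up : cdom c p := chart_at_dom p.
have Yp : Y p = w := coord_field_chart_at p w.
have : 2 * g t p (nabla t N N p) (Y p) = 2 * g 0 p (nabla 0 N N p) (Y p).
  rewrite (metric_nabla_diag _ _ _ _ _ _ (nabla_lc t tD) (cdom_open c) Ns Ys Up).
  rewrite (metric_nabla_diag _ _ _ _ _ _ (nabla_lc 0 zD) (cdom_open c) Ns Ys Up).
  rewrite (gN t tD).
  (* The products are differentiated in space, so they must agree as functions of [q], not only at
     [p]. *)
  have gNE (X : vfield M) :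
      (fun q => g t q (N q) (X q)) = (fun q => g 0 q (N q) (X q)).
    by apply/funext => q; rewrite gN.
  by rewrite !gNE.
rewrite geo0 metric0l mulr0 Yp => /eqP; rewrite mulf_eq0 pnatr_eq0/= => gw0.
apply/eqP; apply: contraTT gw0 => w0.
by rewrite gt_eqF//; exact: metric_pos.
Qed.
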